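(* Let $k$ be a field of any characteristic. For integers $m,n\geq 1$ let $I_{m,n} := (x^m t - y^m z,\; z^{n+2} - x t^{n+1}) \subset k[x,y,z,t]$, where $k[x,y,z,t]$ is the standard graded polynomial ring. Then for all $m,n\geq 1$, $$\operatorname{reg}(I_{m,n}) = m+n+2 \quad\text{and}\quad \operatorname{reg}\left(\sqrt{I_{m,n}}\right) = mn+2.$$
   Context: For a finitely generated graded module $M$ over $R=k[x,y,z,t]$ (all variables of degree 1), $\operatorname{reg}(M)$ is the Castelnuovo-Mumford regularity: $\operatorname{reg}(M)=\max\{i+j : H^i_{\mathfrak m}(M)_j\neq 0\}$ with $\mathfrak m=(x,y,z,t)$; equivalently $\max\{b_{ij}-i\}$, where the $b_{ij}$ are the degrees of the generators of the $i$-th free module in the minimal graded free resolution of $M$. For an ideal $I$, $\operatorname{reg}(I)$ is the regularity of $I$ as a module. *)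

(* Defs.v *)
From HB Require Import structures.
From mathcomp Require Import all_boot all_order all_algebra.
From mathcomp Require Import mpoly.

Set Implicit Arguments.
Unset Strict Implicit.
Unset Printing Implicit Defensive.

Import GRing.Theory Num.Theory.
Local Open Scope ring_scope.

Section Ideals.
Variable R : comNzRingType.

Definition ideal2 (f g : R) : R -> Prop :=
  fun p => exists a b : R, p = a * f + b * g.

Definition radical (I : R -> Prop) : R -> Prop :=
  fun p => exists2 e : nat, (0 < e)%N & I (p ^+ e).

End Ideals.

Section Regularity.
Variables (n : nat) (k : fieldType).
Implicit Type I : {mpoly k[n]} -> Prop.

(* Homogeneity for integer degrees, needed because the entries of a graded map
   of free modules have differences of shifts as degrees. *)
Definition homogz (d : int) (p : {mpoly k[n]}) : Prop :=
  match d with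
  | Posz e => p \is e.-homog
  | Negz _ => p = 0
  end.

(* Graded free resolution
     ... -> F_1 -> F_0 -> I -> 0,  F_i = \bigoplus_j S(- gfr_deg i j),
   of the ideal I of S = k[X_0, ..., X_(n-1)].  Elements of F_i are row vectors
   and maps act by right multiplication.  No bound on the length is imposed:
   F_i = 0 is gfr_rank i = 0. *)
Record graded_free_resolution I := GradedFreeResolution {
  gfr_rank : nat -> nat;
  gfr_deg : forall i, 'I_(gfr_rank i) -> int;
  gfr_aug : 'cV[{mpoly k[n]}]_(gfr_rank 0);
  gfr_diff : forall i, 'M[{mpoly k[n]}]_(gfr_rank i.+1, gfr_rank i);
  gfr_aug_homog : forall j, homogz (gfr_deg j) (gfr_aug j 0);
  gfr_diff_homog : forall i a b,
    homogz (gfr_deg a - gfr_deg b) (gfr_diff i a b);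
  gfr_aug_image : forall p,
    I p <-> exists u : 'rV_(gfr_rank 0), (u *m gfr_aug) 0 0 = p;
  gfr_exact0 : forall u : 'rV_(gfr_rank 0),
    u *m gfr_aug = 0 <->
    exists v : 'rV_(gfr_rank 1), u = v *m gfr_diff 0;
  gfr_exactS : forall i (u : 'rV_(gfr_rank i.+1)),
    u *m gfr_diff i = 0 <->
    exists v : 'rV_(gfr_rank i.+2), u = v *m gfr_diff i.+1
}.

(* The image of F_(i+1) lies in (X_0, ..., X_(n-1)) F_i: the matrix entries
   have zero constant coefficient. *)
Definition gfr_minimal I (F : graded_free_resolution I) : Prop :=
  forall i a b, (gfr_diff F i a b)@_0%MM = 0.

(* reg(I) = r, i.e. r = max {b_ij - i}, the b_ij being the shifts of the
   minimal graded free resolution of I, which is unique up to isomorphism. *)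
Definition is_regularity I (r : int) : Prop :=
  exists F : graded_free_resolution I,
    [/\ gfr_minimal F,
        exists i (j : 'I_(gfr_rank F i)), gfr_deg j - i%:Z = r
      & forall i (j : 'I_(gfr_rank F i)), gfr_deg j - i%:Z <= r].

End Regularity.

Section Imn.
Variable k : fieldType.

Definition var_x : {mpoly k[4]} := 'X_(@Ordinal 4 0 isT).
Definition var_y : {mpoly k[4]} := 'X_(@Ordinal 4 1 isT).
Definition var_z : {mpoly k[4]} := 'X_(@Ordinal 4 2 isT).
Definition var_t : {mpoly k[4]} := 'X_(@Ordinal 4 3 isT).

Definition Imn (m n : nat) : {mpoly k[4]} -> Prop :=
  ideal2 (var_x ^+ m * var_t - var_y ^+ m * var_z)
         (var_z ^+ (n + 2) - var_x * var_t ^+ (n + 1)).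

End Imn.

(* Main.v *)
(* Write [f = x^m t - y^m z], [g = z^(n+2) - x t^(n+1)] and [X = x^m], [Y = y^m].
   Since [f] and [g] form a regular sequence, the Koszul complex resolves [I_(m,n)].

   The radical is generated by [f] and
   [h_p = X^p z^(n+2-p) - x Y^p t^(n+1-p)] for [0 <= p <= n], with [h_0 = g].
   Modulo [f] one has [z h_(p+1) = X h_p] and [t h_(p+1) = Y h_p], so [h_p] behaves
   as [w^p g] with [w = X / z = Y / t].  Hence the relations between the [h_p]
   modulo [f] are, up to degree [n] in [w], those of the pencil [F = z w - X],
   [G = t w - Y], and the degree [n] strand of its Koszul complex gives the
   minimal resolution [0 -> S^(n-1) -> S^(2n) -> S^(n+2)], whose regularity is
   [deg h_n = m n + 2].

   That these elements generate the radical is seen on monomials.  The zero set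
   consists of the lines [x = z = 0], [z = t = 0] and the monomial curve
   [(a^(m(n+2)), a^(m(n+2)-1) b, a^m b^(m(n+1)), b^(m(n+2)))].  Every polynomial is
   congruent modulo the [h_p] and [f] to a combination of monomials that are not
   divisible by any [y^m z] or [x y^(pm) t^(n+1-p)], and such a combination
   vanishes as soon as it vanishes on the three components. *)

Require Import Defs.
From mathcomp Require Import all_boot all_order all_algebra.
From mathcomp Require Import mpoly.
From mathcomp Require Import ring zify.

Set Implicit Arguments.
Unset Strict Implicit.
Unset Printing Implicit Defensive.

Import GRing.Theory Num.Theory.
Local Open Scope ring_scope.

(** * Products with a linear polynomial *)

Section LinearPoly.
Variable R : idomainType.

Lemma size_lin_mulXn (c e : R) i :
  (size ('X^i * (c *: 'X - e%:P) : {poly R})%R <= i.+2)%N.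
Proof.
set A := (X in 'X^i * X).
rewrite (leq_trans (size_polyMleq _ _)) // size_polyXn.
have : (size A <= 2)%N.
  rewrite (leq_trans (size_polyD _ _)) // geq_max size_polyN size_polyC.
  by rewrite (leq_trans (size_scale_leq _ _)) ?size_polyX //; case: eqP.
lia.
Qed.

Lemma lin_mulXnE (c e : R) i : 'X^i * (c *: 'X - e%:P : {poly R}) = c *: 'X^(i.+1) - e *: 'X^i.
Proof. by rewrite mulrBr -scalerAr -exprSr -[_%:P]mulr1 mul_polyC -scalerAr mulr1. Qed.

Lemma coef_lin_mul (c e : R) (a : {poly R}) i :
  (a * (c *: 'X - e%:P))`_i.+1 = a`_i * c - a`_i.+1 * e.
Proof. by rewrite mulrBr coefB -scalerAr coefZ coefMX coefMC mulrC. Qed.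

Lemma coef0_lin_mul (c e : R) (a : {poly R}) : (a * (c *: 'X - e%:P))`_0 = - (a`_0 * e).
Proof. by rewrite mulrBr coefB -scalerAr coefZ coefMX coefMC /= mulr0 sub0r. Qed.

Lemma size_drop_coef d (A : {poly R}) : (size A <= d.+1)%N -> A`_d = 0 -> (size A <= d)%N.
Proof.
move=> sA A0; apply/leq_sizeP => j; rewrite leq_eqVlt => /orP[/eqP <- //|].
by move/leq_sizeP: sA; apply.
Qed.

End LinearPoly.

(** * Relations and syzygies of the pencil [F], [G] *)

Section Pencil.
Variables (R : idomainType) (X Y z t : R).
Let f := X * t - Y * z.
Let F : {poly R} := z *: 'X - X%:P.
Let G : {poly R} := t *: 'X - Y%:P.

(** The degree [d] homogenization of [C] at the point [(X, z)], in other words [z^d C(X / z)]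
    without denominators. *)
Definition hom_eval d (C : {poly R}) := \sum_(p < d.+1) C`_p * X ^+ p * z ^+ (d - p).

Lemma hom_evalD d : {morph hom_eval d : A B / A + B}.
Proof.
by move=> A B; rewrite -big_split; apply: eq_bigr => i _; rewrite coefD !mulrDl.
Qed.

Lemma hom_evalZ d c A : hom_eval d (c *: A) = c * hom_eval d A.
Proof.
by rewrite mulr_sumr; apply: eq_bigr => i _; rewrite coefZ !mulrA.
Qed.

Lemma hom_evalS d A :
  hom_eval d.+1 A = hom_eval d A * z + A`_d.+1 * X ^+ d.+1.
Proof.
rewrite /hom_eval big_ord_recr /= subnn expr0 mulr1; congr (_ + _).
rewrite mulr_suml; apply: eq_bigr => i _.
by rewrite -[RHS]mulrA -exprSr subSn // -ltnS.
Qed.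

Lemma hom_evalXn d i : (i <= d)%N -> hom_eval d 'X^i = X ^+ i * z ^+ (d - i).
Proof.
move=> le_id; rewrite /hom_eval (bigD1 (Ordinal (le_id : i < d.+1)%N)) //= coefXn eqxx mul1r.
by rewrite big1 ?addr0 // => j /negbTE; rewrite -val_eqE coefXn /= => ->; rewrite !mul0r.
Qed.

(** These conditions say that [z, t] has only Koszul syzygies, that [X] is regular modulo [z] and
    modulo [(z, t)], and that [z] is regular modulo [f]. *)
Hypothesis zt_syz :
  forall a b, a * z + b * t = 0 -> exists s, a = s * t /\ b = - (s * z).
Hypothesis z_reg_X : forall a s, X * a = s * z -> exists s', a = s' * z.
Hypothesis X_reg_zt : forall a i (u v : R), a * X ^+ i = u * z + v * t ->
  exists u' v', a = u' * z + v' * t.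
Hypothesis z_reg_f : forall a s, a * z = s * f -> exists s', a = s' * f.
Hypothesis f_neq0 : f != 0.

(** Induction on [d], removing the top coefficient [c] of [C]. Modulo [z] the equation reads
    [X (c X^d - q t) = 0], so [c X^d] lies in [(z, t)], and then so does [c = u z + v t].
    Subtracting [u w^d F + v w^d G] lowers the degree; the evaluation then has a factor [z], which
    cancels modulo [f]. *)
Lemma pencil_relation d (C : {poly R}) q : (size C <= d.+1)%N -> hom_eval d C = q * f ->
  exists (a b : {poly R}) s, [/\ (size a <= d)%N, (size b <= d)%N & C = a * F + b * G + (s * f)%:P].
Proof.
elim: d C q => [|d IHd] C q sC EC.
  exists 0, 0, q; rewrite size_poly0 !mul0r !add0r; split=> //.
  rewrite (size1_polyC sC); congr _%:P; rewrite -EC /hom_eval big_ord1 /=.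
  by rewrite !mulr1.
have Ed := hom_evalS d C.
have [s1 Es1] : exists s, C`_d.+1 * X ^+ d - q * t = s * z.
  apply: (@z_reg_X _ (- (hom_eval d C) - q * Y)).
  move: Ed; rewrite EC /f exprS => Ed.
  have -> : X * (C`_d.+1 * X ^+ d - q * t) =
    C`_d.+1 * (X * X ^+ d) - q * (X * t - Y * z) - q * Y * z by ring.
  by rewrite Ed; ring.
have [u [v Euv]] : exists u v, C`_d.+1 = u * z + v * t.
  by apply: (@X_reg_zt _ d s1 q); rewrite -Es1; ring.
(* In degree [d + 1], [w^d F] evaluates to [0] and [w^d G] to [X^d f], so the evaluation remains a
   multiple of [f]. *)
pose C' := C - u *: ('X^d * F) - v *: ('X^d * G).
have EC' : hom_eval d.+1 C' = (q - v * X ^+ d) * f.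
  rewrite /C' /F /G !lin_mulXnE -!scaleNr !hom_evalD !hom_evalZ !hom_evalD.
  rewrite !hom_evalZ !hom_evalXn // subnn subSnn EC /f exprS.
  ring.
have C'0 : C'`_d.+1 = 0.
  rewrite /C' /F /G !lin_mulXnE !coefB !coefZ !coefB !coefZ !coefXn eqxx Euv.
  by rewrite gtn_eqF //= mulr1n mulr0n; ring.
have sC' : (size C' <= d.+1)%N.
  apply: size_drop_coef => //.
  do 2![rewrite (leq_trans (size_polyD _ _)) // geq_max size_polyN; apply/andP; split => //;
    last by rewrite (leq_trans (size_scale_leq _ _)) // size_lin_mulXn].
have [s' Es'] : exists s', hom_eval d C' = s' * f.
  by apply: z_reg_f (q - v * X ^+ d) _; rewrite -EC' hom_evalS C'0 mul0r addr0.
have [a [b [s [sa sb Eab]]]] := IHd _ _ sC' Es'.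
have sX (c e : R) (A : {poly R}) : (size A <= d)%N -> (size (A + c *: 'X^d)%R <= d.+1)%N.
  move=> sA; rewrite (leq_trans (size_polyD _ _)) // geq_max leqW //=.
  by rewrite (leq_trans (size_scale_leq _ _)) // size_polyXn.
exists (a + u *: 'X^d), (b + v *: 'X^d), s; split; [exact: sX|exact: sX|].
rewrite -[C](subrK (u *: ('X^d * F))) -[X in X + _](subrK (v *: ('X^d * G))) -/C'.
by rewrite Eab -!mul_polyC; ring.
Qed.

(* [f = z G - t F] is itself in the pencil, at the cost of one degree. *)
Lemma pencil_relation_pos d (C : {poly R}) q : (size C <= d.+2)%N ->
  hom_eval d.+1 C = q * f ->
  exists a b : {poly R}, [/\ (size a <= d.+1)%N, (size b <= d.+1)%N & C = a * F + b * G].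
Proof.
move=> sC /(pencil_relation sC) [a [b [s [sa sb ->]]]].
have sX (c : R) (A : {poly R}) : (size A <= d.+1)%N -> (size (A + c%:P)%R <= d.+1)%N.
  move=> sA; rewrite (leq_trans (size_polyD _ _)) // geq_max sA /= size_polyC.
  by case: eqP.
exists (a + (- s * t)%:P), (b + (s * z)%:P); split; [exact: sX|exact: sX|].
rewrite /F /G /f -!mul_polyC !(rmorphB, rmorphM, rmorphN) /=; ring.
Qed.

(** The top coefficients of [a] and [b] form a syzygy of [(z, t)], hence are [s t] and [- s z];
    subtracting [s w^e (G, - F)] for a suitable [e] lowers the degree. For constants, the
    coefficient of [w^0] gives [s f = 0], so nothing is left: this is where the bound [d.-1] comes
    from. *)
Lemma pencil_syzygy d (a b : {poly R}) : (size a <= d)%N -> (size b <= d)%N ->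
  a * F + b * G = 0 ->
  exists s : {poly R}, [/\ (size s <= d.-1)%N, a = s * G & b = - s * F].
Proof.
have top e (u v : {poly R}) : (size u <= e.+1)%N -> (size v <= e.+1)%N ->
    u * F + v * G = 0 -> exists s, u`_e = s * t /\ v`_e = - (s * z).
  move=> su sv /polyP/(_ e.+1); rewrite coefD !coef_lin_mul coef0.
  rewrite (nth_default _ su) (nth_default _ sv) !mul0r !subr0; exact: zt_syz.
elim: d a b => [|[|d] IHd] a b sa sb ab0.
- exists 0; rewrite size_poly0 mul0r oppr0 mul0r.
  by split=> //; apply/eqP; rewrite -size_poly_leq0.
- have [s [as_ bs]] := top _ _ _ sa sb ab0.
  suff s0: s = 0.
    exists 0; rewrite size_poly0 mul0r oppr0 mul0r (size1_polyC sa) (size1_polyC sb).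
    by rewrite as_ bs s0 !mul0r oppr0.
  apply/eqP; move/polyP/(_ 0%N)/eqP: ab0.
  rewrite coefD !coef0_lin_mul coef0 as_ bs => H.
  have : s * f == 0 by rewrite -oppr_eq0 -(eqP H) /f; apply/eqP; ring.
  by rewrite mulf_eq0 (negbTE f_neq0) orbF.
have [s [as_ bs]] := top _ _ _ sa sb ab0.
have sz (A P : {poly R}) : (size A <= d.+2)%N -> (size ('X^d * P)%R <= d.+2)%N ->
    A`_d.+1 = s * ('X^d * P)`_d.+1 -> (size (A - s *: ('X^d * P))%R <= d.+1)%N.
  move=> sA sP EA; apply: size_drop_coef; last by rewrite coefB coefZ EA subrr.
  rewrite (leq_trans (size_polyD _ _)) // geq_max sA size_polyN.
  by rewrite (leq_trans (size_scale_leq _ _)).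
have [||//|s' [ss' Ea Eb]] := IHd (a - s *: ('X^d * G)) (b - s *: ('X^d * - F)).
- apply: sz; rewrite ?size_lin_mulXn // mulrC coef_lin_mul !coefXn eqxx gtn_eqF //= mulr1n mulr0n.
  by rewrite as_; ring.
- apply: sz; rewrite ?mulrN ?size_polyN ?size_lin_mulXn // coefN mulrC coef_lin_mul.
  by rewrite !coefXn eqxx gtn_eqF //= mulr1n mulr0n bs; ring.
- by rewrite -[RHS]ab0 -!mul_polyC; ring.
exists (s' + s *: 'X^d); split=> /=.
- rewrite (leq_trans (size_polyD _ _)) // geq_max (leq_trans ss') //=.
  by rewrite (leq_trans (size_scale_leq _ _)) // size_polyXn.
- by rewrite -[a](subrK (s *: ('X^d * G))) Ea -!mul_polyC; ring.
- by rewrite -[b](subrK (s *: ('X^d * - F))) Eb -!mul_polyC; ring.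
Qed.

End Pencil.

(** * Multiplication by a polynomial as a matrix *)

Section Band.
Variable R : idomainType.

(* Row vectors stand for polynomials in [w] of bounded degree, and [band d e P] is
   multiplication by [P]. *)
Definition band d e (P : {poly R}) : 'M[R]_(d, e) :=
  lin1_mx (poly_rV \o (P \o* rVpoly)).

Lemma bandE d e P (i : 'I_d) (j : 'I_e) : band d e P i j = ('X^i * P)`_j.
Proof. by rewrite mxE /= rVpoly_delta mxE. Qed.

Lemma rVpoly_inj d : injective (@rVpoly R d).
Proof. exact: can_inj rVpolyK. Qed.

(** [poly_rV] truncates at length [e], but a product with a linear polynomial has length at most
    [d + 1 <= e]. *)
Lemma mul_band d e (v : 'rV_d) (P : {poly R}) : (size P <= 2)%N -> (d < e)%N ->
  rVpoly (v *m band d e P) = rVpoly v * P.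
Proof.
move=> sP de; rewrite mul_rV_lin1 /= poly_rV_K //.
rewrite (leq_trans (size_polyMleq _ _)) // -ltnS.
have := leq_add (size_poly d _ : (size (rVpoly v) <= d)%N) sP.
by case: (_ + _)%N => //= s; rewrite addn2 ltnS => /leq_trans; apply.
Qed.

Lemma band_lin_mul d e (A : 'cV_e) c b (p : 'I_d) (le_pe : (p.+1 < e)%N) :
  (band d e (c *: 'X - b%:P) *m A) p 0 =
  c * A (Ordinal le_pe) 0 - b * A (Ordinal (ltnW le_pe)) 0.
Proof.
rewrite mxE (bigD1 (Ordinal le_pe)) //= (bigD1 (Ordinal (ltnW le_pe))) /=; last first.
  by rewrite -val_eqE /= neq_ltn ltnSn.
rewrite !bandE lin_mulXnE !(coefB, coefZ, coefXn) /= !eqxx gtn_eqF // ltn_eqF //=.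
rewrite big1 ?addr0 => [|j /andP[jp1 jp]]; first by rewrite mulr1n mulr0n; ring.
rewrite bandE lin_mulXnE !(coefB, coefZ, coefXn).
move: jp1 jp; rewrite -!val_eqE /= => /negbTE -> /negbTE ->.
by rewrite !mulr0 subrr mul0r.
Qed.

Lemma size_lin (c b : R) : (size (c *: 'X - b%:P : {poly R})%R <= 2)%N.
Proof. by have := size_lin_mulXn c b 0%N; rewrite expr0 mul1r. Qed.

End Band.

(** * Exactness of the resolution of the ideal generated by [f] and the [h_p] *)

Section RadicalResolution.

Variables (R : idomainType) (x X Y z t : R) (N : nat).
Let n := N.+1.
Let f := X * t - Y * z.
Let F : {poly R} := z *: 'X - X%:P.
Let G : {poly R} := t *: 'X - Y%:P.

(** The element [h_p] for [n = N + 1]; this choice of [N] makes the rank [n - 1] of the last module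
    equal to [N]. *)
Definition rad_gen (p : nat) := X ^+ p * z ^+ (n.+1 - p).+1 - x * Y ^+ p * t ^+ (n.+1 - p).
Local Notation h := rad_gen.

Definition rad_aug : 'cV[R]_(1 + n.+1) := col_mx f%:M (\col_(p < n.+1) h p).
(** The rows are the relations [rad_gen_z] and [rad_gen_t]: the bands act on the [h_p], and the
    first column holds the correcting multiple of [f]. *)
Definition rad_diff0 : 'M[R]_(n + n, 1 + n.+1) :=
  block_mx (\col_(p < n) - (x * Y ^+ p * t ^+ (n - p))) (band n n.+1 F)
           (\col_(p < n) - (X ^+ p * z ^+ (n - p).+1)) (band n n.+1 G).
Definition rad_diff1 : 'M[R]_(N, n + n) := row_mx (band N n G) (- band N n F).

Lemma rad_gen_z p : (p <= n)%N -> z * h p.+1 = X * h p + x * Y ^+ p * t ^+ (n - p) * f.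
Proof. by move=> pn; rewrite /h subSS (subSn pn) !exprS /f; ring. Qed.

Lemma rad_gen_t p : (p <= n)%N -> t * h p.+1 = Y * h p + X ^+ p * z ^+ (n - p).+1 * f.
Proof. by move=> pn; rewrite /h subSS (subSn pn) !exprS /f; ring. Qed.

(** Iterating [rad_gen_z]: modulo [f], [h_p] is [(X / z)^p h_0], and [z^p] clears the
    denominator. *)
Lemma rad_gen_zX p : (p <= n.+1)%N -> exists q, z ^+ p * h p = X ^+ p * h 0 + q * f.
Proof.
elim: p => [|p IHp] pn; first by exists 0; rewrite !expr0 mul0r addr0.
have [q Eq] := IHp (ltnW pn); rewrite !exprS.
exists (X * q + z ^+ p * (x * Y ^+ p * t ^+ (n - p))).
have -> : z * z ^+ p * h p.+1 = z ^+ p * (z * h p.+1) by ring.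
rewrite rad_gen_z //; have -> : X * X ^+ p * h 0 = X * (X ^+ p * h 0 + q * f) - X * q * f by ring.
by rewrite -Eq; ring.
Qed.

Lemma rad_gen_tY p : (p <= n.+1)%N -> exists q, t ^+ p * h p = Y ^+ p * h 0 + q * f.
Proof.
elim: p => [|p IHp] pn; first by exists 0; rewrite !expr0 mul0r addr0.
have [q Eq] := IHp (ltnW pn); rewrite !exprS.
exists (Y * q + t ^+ p * (X ^+ p * z ^+ (n - p).+1)).
have -> : t * t ^+ p * h p.+1 = t ^+ p * (t * h p.+1) by ring.
rewrite rad_gen_t //; have -> : Y * Y ^+ p * h 0 = Y * (Y ^+ p * h 0 + q * f) - Y * q * f by ring.
by rewrite -Eq; ring.
Qed.

Lemma mul_rad_aug (c : 'rV_1) (C : 'rV_n.+1) :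
  (row_mx c C *m rad_aug) 0 0 = c 0 0 * f + \sum_(p < n.+1) C 0 p * h p.
Proof.
rewrite mul_row_col mxE; congr (_ + _).
  by rewrite mxE big_ord1 mxE eqxx mulr1n.
by rewrite mxE; apply: eq_bigr => i _; rewrite mxE.
Qed.

(** The [f]-coordinate is left unnamed: for a syzygy, [mul_rad_aug_inj] determines it from the other
    coordinates. *)
Lemma mul_rad_diff0 (a b : 'rV_n) : exists c,
  row_mx a b *m rad_diff0 = row_mx c (a *m band n n.+1 F + b *m band n n.+1 G).
Proof. by rewrite mul_row_block; eexists. Qed.

Lemma rad_diff0_aug : rad_diff0 *m rad_aug = 0.
Proof.
rewrite mul_block_col -[RHS]col_mx0; congr col_mx; apply/colP => p.
  have lep : (p.+1 < n.+1)%N := ltn_ord p.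
  rewrite mxE (band_lin_mul _ _ _ lep) !mxE big_ord1 !mxE eqxx mulr1n /=.
  by rewrite rad_gen_z ?(ltnW (ltn_ord p)) //; ring.
have lep : (p.+1 < n.+1)%N := ltn_ord p.
  rewrite mxE (band_lin_mul _ _ _ lep) !mxE big_ord1 !mxE eqxx mulr1n /=.
by rewrite rad_gen_t ?(ltnW (ltn_ord p)) //; ring.
Qed.

Hypothesis zt_syz :
  forall a b, a * z + b * t = 0 -> exists s, a = s * t /\ b = - (s * z).
Hypothesis z_reg_X : forall a s, X * a = s * z -> exists s', a = s' * z.
Hypothesis X_reg_zt : forall a i (u v : R), a * X ^+ i = u * z + v * t ->
  exists u' v', a = u' * z + v' * t.
Hypothesis z_reg_f : forall a s, a * z = s * f -> exists s', a = s' * f.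
Hypothesis h0_reg_f : forall a s, a * h 0 = s * f -> exists s', a = s' * f.
Hypothesis f_neq0 : f != 0.

Lemma mul_rad_aug_inj (c c' : 'rV_1) (C : 'rV_n.+1) :
  row_mx c C *m rad_aug = 0 -> row_mx c' C *m rad_aug = 0 -> c = c'.
Proof.
move=> /matrixP/(_ 0 0) + /matrixP/(_ 0 0); rewrite !mul_rad_aug mxE => H1 H2.
apply/rowP => i; rewrite ord1; apply: (mulIf f_neq0); apply: (addIr (\sum_(p < n.+1) C 0 p * h p)).
by rewrite H1 H2.
Qed.

(** Multiplying a relation between the [h_p] modulo [f] by [z^n] and replacing [z^p h_p] by
    [X^p h_0] gives [hom_eval C * h_0] in [(f)]. Cancelling [h_0] modulo [f] leaves the situation of
    [pencil_relation_pos]. *)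
Lemma rad_exact0 (u : 'rV_(1 + n.+1)) :
  u *m rad_aug = 0 <-> exists v : 'rV_(n + n), u = v *m rad_diff0.
Proof.
split=> [|[v ->]]; last by rewrite -mulmxA rad_diff0_aug mulmx0.
rewrite -[u]hsubmxK; move: (lsubmx u) (rsubmx u) => c C u0.
have [q Eq] : exists q, hom_eval X z n (rVpoly C) * h 0 = q * f.
  have [q Eq] : exists q, \sum_(p < n.+1)
      ((rVpoly C)`_p * X ^+ p * z ^+ (n - p) * h 0 - z ^+ n * (C 0 p * h p)) = q * f.
    apply: (big_ind (fun s => exists q, s = q * f)) => [|_ _ [a ->] [b ->]|p _].
    - by exists 0; rewrite mul0r.
    - by exists (a + b); rewrite mulrDl.
    have [q Eq] := rad_gen_zX (ltnW (ltn_ord p)).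
    exists (- (C 0 p * z ^+ (n - p) * q)); rewrite coef_rVpoly_ord.
    have -> : z ^+ n * (C 0 p * h p) = C 0 p * z ^+ (n - p) * (z ^+ p * h p).
      by rewrite -{1}(subnK (leq_ord p)) exprD; ring.
    by rewrite Eq; ring.
  move/matrixP/(_ 0 0): u0; rewrite mul_rad_aug mxE => /(canRL (addKr _)); rewrite addr0 => u0.
  exists (q - z ^+ n * c 0 0); rewrite mulrBl -Eq sumrB -mulr_sumr u0 mulr_suml; ring.
have [s Es] := h0_reg_f Eq.
have [|a [b [sa sb Eab]]] := pencil_relation_pos z_reg_X X_reg_zt z_reg_f _ Es.
  by rewrite size_poly.
exists (row_mx (poly_rV a) (poly_rV b)).
have [c' Ec'] := mul_rad_diff0 (poly_rV a) (poly_rV b).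
have EC : C = poly_rV a *m band n n.+1 F + poly_rV b *m band n n.+1 G.
  by apply: rVpoly_inj; rewrite linearD /= !mul_band ?size_lin // !poly_rV_K.
rewrite Ec' -EC; congr row_mx; apply: mul_rad_aug_inj u0 _.
by rewrite EC -Ec' -mulmxA rad_diff0_aug mulmx0.
Qed.

(** The band part of the product is [a F + b G], so [pencil_syzygy] applies. Conversely
    [(s G, - s F)] has zero band part, and its [f]-coordinate vanishes because that of a syzygy is
    determined by the rest. *)
Lemma rad_exact1 (u : 'rV_(n + n)) :
  u *m rad_diff0 = 0 <-> exists v : 'rV_N, u = v *m rad_diff1.
Proof.
have bandFG (a b : 'rV_n) : rVpoly (a *m band n n.+1 F + b *m band n n.+1 G) =
    rVpoly a * F + rVpoly b * G.
  by rewrite linearD /= !mul_band ?size_lin.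
split=> [|[v ->]].
  rewrite -[u]hsubmxK; move: (lsubmx u) (rsubmx u) => a b.
  have [c ->] := mul_rad_diff0 a b.
  rewrite -[X in _ = X]row_mx0 => H.
have [_ /(congr1 (@rVpoly R _))] := eq_row_mx H.
  rewrite bandFG linear0 => ab0.
  have [sa sb] : (size (rVpoly a) <= n)%N /\ (size (rVpoly b) <= n)%N.
    by rewrite !size_poly.
  have [s [ss Ea Eb]] := pencil_syzygy zt_syz f_neq0 sa sb ab0.
  exists (poly_rV s); rewrite mul_mx_row mulmxN.
  by congr row_mx; apply: rVpoly_inj; rewrite ?linearN /= mul_band ?size_lin // poly_rV_K // -mulNr.
rewrite mul_mx_row; have [c Ec] := mul_rad_diff0 (v *m band N n G) (v *m - band N n F).
have E0 : v *m band N n G *m band n n.+1 F + v *m - band N n F *m band n n.+1 G = 0.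
  apply: rVpoly_inj; rewrite bandFG linear0 mulmxN linearN /= !mul_band ?size_lin //; ring.
rewrite Ec E0 (_ : c = 0) ?row_mx0 //; apply: (@mul_rad_aug_inj _ _ 0).
  by rewrite -E0 -Ec -mulmxA rad_diff0_aug mulmx0.
by rewrite row_mx0 mul0mx.
Qed.

Lemma rad_exact2 (u : 'rV_N) : z != 0 -> u *m rad_diff1 = 0 -> u = 0.
Proof.
move=> z0; rewrite mul_mx_row -[X in _ = X]row_mx0 => H.
have [_ /(congr1 (@rVpoly R _))] := eq_row_mx H.
rewrite mulmxN linearN /= mul_band ?size_lin // linear0 => /eqP; rewrite oppr_eq0 mulf_eq0.
case/orP=> [/eqP u0|/eqP/polyP/(_ 1%N)/eqP]; first by apply: rVpoly_inj; rewrite u0 linear0.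
by rewrite coefB coefZ coefX coefC subr0 coef0 mulr1 (negbTE z0).
Qed.

End RadicalResolution.

(** * Regularity read off a minimal resolution of length at most two *)

Section ShortResolution.
Variables (N : nat) (K : fieldType) (r0 r1 r2 : nat).
Variables (e0 : 'I_r0 -> int) (e1 : 'I_r1 -> int) (e2 : 'I_r2 -> int).
Variables (v : 'cV[{mpoly K[N]}]_r0) (d0 : 'M[{mpoly K[N]}]_(r1, r0)).
Variable d1 : 'M[{mpoly K[N]}]_(r2, r1).

Definition short_rank i :=
  match i with 0 => r0 | 1 => r1 | 2 => r2 | _ => 0%N end.

Definition short_deg i : 'I_(short_rank i) -> int :=
  match i with 0 => e0 | 1 => e1 | 2 => e2 | _ => fun=> 0 end.

Definition short_diff i : 'M[{mpoly K[N]}]_(short_rank i.+1, short_rank i) :=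
  match i with 0 => d0 | 1 => d1 | _ => 0 end.

(** The resolution is continued by zero modules, which contribute no shifts. *)
Lemma is_regularity_short (I : {mpoly K[N]} -> Prop) (r : int) :
  (forall j, homogz (e0 j) (v j 0)) ->
  (forall a b, homogz (e1 a - e0 b) (d0 a b)) ->
  (forall a b, homogz (e2 a - e1 b) (d1 a b)) ->
  (forall p, I p <-> exists u : 'rV_r0, (u *m v) 0 0 = p) ->
  (forall u : 'rV_r0, u *m v = 0 <-> exists w : 'rV_r1, u = w *m d0) ->
  (forall u : 'rV_r1, u *m d0 = 0 <-> exists w : 'rV_r2, u = w *m d1) ->
  (forall u : 'rV_r2, u *m d1 = 0 -> u = 0) ->
  (forall a b, (d0 a b)@_0%MM = 0) -> (forall a b, (d1 a b)@_0%MM = 0) ->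
  (forall j, e0 j <= r) -> (forall j, e1 j - 1 <= r) -> (forall j, e2 j - 2 <= r) ->
  (exists j, e0 j = r) \/ (exists j, e1 j - 1 = r) ->
  is_regularity I r.
Proof.
move=> hv hd0 hd1 im ex0 ex1 ex2 min0 min1 le0 le1 le2 att.
have hd i a b : homogz (short_deg a - short_deg b) (short_diff i a b).
  case: i a b => [|[|i]] a b; [exact: hd0|exact: hd1|].
  by rewrite mxE; case: (_ - _) => // e; apply: dhomog0.
have exS i (u : 'rV_(short_rank i.+1)) : u *m short_diff i = 0 <->
    exists w : 'rV_(short_rank i.+2), u = w *m short_diff i.+1.
  case: i u => [|[|i]] u; first exact: ex1.
    split=> [/ex2 -> | [w ->]]; first by exists 0; rewrite mul0mx.
    by rewrite mulmx0 mul0mx.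
  by split=> _; [exists 0; rewrite [u]thinmx0 mul0mx | rewrite mulmx0].
exists (@GradedFreeResolution N K I short_rank short_deg v short_diff hv hd im ex0 exS).
split=> [i a b||i j] /=.
- by case: i a b => [|[|i]] a b; [exact: min0|exact: min1|rewrite mxE mcoeff0].
- case: att => [[j Ej]|[j Ej]]; last by exists 1%N, j.
  by exists 0%N, j; rewrite subr0.
case: i j => [|[|[|i]]] j; [by rewrite subr0; exact: le0|exact: le1|exact: le2|].
by case: j.
Qed.

End ShortResolution.

(** * Ideals as predicates *)

Definition is_ideal (R : comNzRingType) (J : R -> Prop) :=
  [/\ J 0, forall a b, J a -> J b -> J (a + b) & forall c a, J a -> J (c * a)].

Section IdealFacts.
Variables (R : comNzRingType) (J : R -> Prop).
Hypothesis idJ : is_ideal J.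

Lemma ideal_sum (T : eqType) (s : seq T) (F : T -> R) :
  (forall i, i \in s -> J (F i)) -> J (\sum_(i <- s) F i).
Proof.
case: idJ => J0 JD _ JF; rewrite big_seq_cond.
by apply: big_ind => [|a b|i /andP[/JF]]; [exact: J0|exact: JD|].
Qed.

End IdealFacts.

Lemma ideal2_is_ideal (R : comNzRingType) (f g : R) : is_ideal (ideal2 f g).
Proof.
split=> [|_ _ [a [b ->]] [a' [b' ->]]|c _ [a [b ->]]].
- by exists 0, 0; rewrite !mul0r addr0.
- by exists (a + a'), (b + b'); ring.
- by exists (c * a), (c * b); ring.
Qed.

Lemma multiples_is_ideal (R : comNzRingType) (f : R) : is_ideal (fun a => exists s, a = s * f).
Proof.
split=> [|_ _ [a ->] [b ->]|c _ [a ->]]; first by exists 0; rewrite mul0r.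
- by exists (a + b); rewrite mulrDl.
- by exists (c * a); rewrite mulrA.
Qed.

Lemma col_ideal_is_ideal (R : comNzRingType) r (v : 'cV[R]_r) :
  is_ideal (fun p => exists u : 'rV_r, (u *m v) 0 0 = p).
Proof.
split=> [|_ _ [a <-] [b <-]|c _ [a <-]]; first by exists 0; rewrite mul0mx mxE.
- by exists (a + b); rewrite mulmxDl mxE.
- by exists (c *: a); rewrite -scalemxAl mxE.
Qed.

(** * Normal forms and monomial substitutions *)

Section Substitutions.
Variables (N : nat) (K : fieldType).
Implicit Types (p r : {mpoly K[N]}) (A : pred 'I_N) (m : 'X_{1..N}).

(** Binomial relations rewrite monomials to monomials, so termination is measured by [mu] on one
    monomial at a time and extends linearly. *)
Lemma normal_form (J : {mpoly K[N]} -> Prop) (normal : pred 'X_{1..N})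
    (mu : 'X_{1..N} -> nat) : is_ideal J ->
  (forall m, ~~ normal m -> exists m', (mu m' < mu m)%N /\ J ('X_[m] - 'X_[m'])) ->
  forall p, exists r, J (p - r) /\ {in msupp r, forall m, normal m}.
Proof.
move=> idJ red; have [J0 JD JM] := idJ.
have redX m : exists m', J ('X_[m] - 'X_[m']) /\ normal m'.
  have [e] := ubnP (mu m); elim: e m => // e IHe m; rewrite ltnS => le_me.
  have [nm|/red[m' [lt_m'm Jmm']]] := boolP (normal m).
    by exists m; rewrite subrr.
  have [m'' [Jm'm'' nm'']] := IHe m' (leq_trans lt_m'm le_me).
  by exists m''; split=> //; rewrite -(subrKA 'X_[m']); apply: JD.
move=> p; rewrite [p]mpolyE; elim: (msupp p) => [|m s [r [Jr nr]]].
  by exists 0; rewrite big_nil subrr; split=> // m; rewrite msupp0.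
have [m' [Jm nm']] := redX m; rewrite big_cons.
exists (p@_m *: 'X_[m'] + r); split.
  rewrite opprD addrACA; apply: JD => //; rewrite -scalerBr -mul_mpolyC; exact: JM.
move=> m''; move/msuppD_le; rewrite mem_cat => /orP[/msuppZ_le|/nr//].
by rewrite msuppX inE => /eqP ->.
Qed.

Lemma coef_comp_mpoly l (lq : N.-tuple {mpoly K[l]}) p mu :
  (p \mPo lq)@_mu = \sum_(m <- msupp p) p@_m * ('X_[m] \mPo lq)@_mu.
Proof.
by rewrite comp_mpolyEX raddf_sum; apply: eq_bigr => m _; rewrite /= mcoeffZ.
Qed.

Lemma comp_mpoly_monomials l (w : 'I_N -> 'X_{1..l}) m :
  'X_[m] \mPo [tuple 'X_[K, w i] | i < N] = 'X_[(\sum_i w i *+ m i)%MM].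
Proof.
rewrite comp_mpolyX -mprodXnE; apply: eq_bigr => i _.
by rewrite tnth_mktuple.
Qed.

(** Distinct monomials of [p] have distinct images, so nothing cancels and each coefficient of [p]
    is a coefficient of the image. *)
Lemma comp_monomials_inj l (w : 'I_N -> 'X_{1..l}) p :
  {in msupp p &, injective (fun m => \sum_i w i *+ m i)%MM} ->
  p \mPo [tuple 'X_[K, w i] | i < N] = 0 -> p = 0.
Proof.
move=> inj_w p0; apply/mpolyP => m; rewrite mcoeff0.
have [pm|/memN_msupp_eq0 //] := boolP (m \in msupp p).
have := congr1 (mcoeff (\sum_i w i *+ m i)%MM) p0.
rewrite coef_comp_mpoly mcoeff0 (bigD1_seq m) ?msupp_uniq //=.
rewrite comp_mpoly_monomials mcoeffX eqxx mulr1 big_seq_cond big1 ?addr0 //.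
move=> m' /andP[pm' ne_m'm]; rewrite comp_mpoly_monomials mcoeffX.
by case: eqP => [/inj_w e|]; [rewrite e ?eqxx in ne_m'm|rewrite mulr0].
Qed.

End Substitutions.

(** * Setting some of the variables to zero *)

Definition kill_tuple N (K : fieldType) (A : pred 'I_N) : N.-tuple {mpoly K[N]} :=
  [tuple if A i then 0 else 'X_i | i < N].

Local Notation kill N K A := (comp_mpoly (@kill_tuple N K A)).

Section Kill.
Variables (N : nat) (K : fieldType) (A : pred 'I_N).
Implicit Types (p r : {mpoly K[N]}) (m : 'X_{1..N}).

Lemma killU i : kill N K A 'X_i = if A i then 0 else 'X_i.
Proof. by rewrite comp_mpolyXU -tnth_nth tnth_mktuple. Qed.

Lemma killX m : kill N K A 'X_[m] =
  if [forall i, A i ==> (m i == 0%N)] then 'X_[m] else 0.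
Proof.
rewrite comp_mpolyX; case: ifPn => [/forallP mA|].
  rewrite [RHS]mpolyXE_id; apply: eq_bigr => i _; rewrite tnth_mktuple.
  by move: (mA i); case: (A i) => //= /eqP ->; rewrite !expr0.
case/forallPn => i; rewrite negb_imply => /andP[Ai mi].
by rewrite (bigD1 i) //= tnth_mktuple Ai expr0n (negbTE mi) mul0r.
Qed.

(** The monomials that the substitution changes are divisible by a variable in [A]. *)
Lemma kill_ideal (J : {mpoly K[N]} -> Prop) p : is_ideal J ->
  (forall i, A i -> J 'X_i) -> J (p - kill N K A p).
Proof.
move=> idJ JA; have [J0 JD JM] := idJ.
rewrite comp_mpolyEX {1}[p]mpolyE -sumrB; apply: (ideal_sum idJ) => m _ /=.
rewrite -scalerBr -mul_mpolyC; apply: (JM); rewrite killX.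
case: ifPn => [_|/forallPn[i]]; first by rewrite subrr.
rewrite negb_imply => /andP[Ai mi]; rewrite subr0.
have -> : m = (m - U_(i) + U_(i))%MM.
  apply/mnmP => j; rewrite mnmDE mnmBE mnm1E.
  by case: eqP => [<-|_]; rewrite ?subn0 ?addn0 // subnK // lt0n.
by rewrite mpolyXD; apply: (JM); apply: JA.
Qed.

Lemma kill_coef p m : [forall i, A i ==> (m i == 0%N)] -> (kill N K A p)@_m = p@_m.
Proof.
move=> mA; rewrite comp_mpolyEX [in RHS](mpolyE p) !raddf_sum /=.
apply: eq_bigr => m' _; rewrite !mcoeffZ killX; case: ifPn => // m'A.
rewrite mcoeff0 mcoeffX; case: eqP => // em; by rewrite em mA in m'A.
Qed.

End Kill.

(** * The [h_p] lie in the radical *)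

Section Radical.
Variables (R : idomainType) (x X Y z t : R) (N : nat).
Let n := N.+1.
Let f := X * t - Y * z.
Local Notation h := (rad_gen x X Y z t N).

Definition rad_ideal (p : R) := exists u : 'rV_(1 + n.+1), (u *m rad_aug x X Y z t N) 0 0 = p.

Lemma rad_ideal_f : rad_ideal f.
Proof.
exists (row_mx 1 0); rewrite mul_rad_aug mxE eqxx mul1r big1 ?addr0 // => p _.
by rewrite mxE mul0r.
Qed.

Lemma rad_ideal_gen p : (p <= n)%N -> rad_ideal (h p).
Proof.
rewrite -ltnS => pn; exists (row_mx 0 (delta_mx 0 (Ordinal pn))).
rewrite mul_rad_aug mxE mul0r add0r (bigD1 (Ordinal pn)) //= mxE !eqxx mul1r.
by rewrite big1 ?addr0 // => j /negbTE jp; rewrite mxE jp andbF mul0r.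
Qed.

(** Each term of [(a u + b v)^(i + j)] contains [u^i] or [v^j]; the induction on [i + j] splits off
    one factor [a u + b v]. *)
Lemma ideal2_expr (u v p : R) i j :
  ideal2 u v p -> ideal2 (u ^+ i) (v ^+ j) (p ^+ (i + j)).
Proof.
move=> [a [b Ep]]; have [s] := ubnP (i + j); elim: s i j => // s IHs [|i] [|j] ijs.
- by exists 1, 0; rewrite mul1r mul0r addr0.
- by exists (p ^+ j.+1), 0; rewrite mulr1 mul0r addr0.
- by exists 0, (p ^+ (i.+1 + 0)); rewrite mulr1 mul0r add0r.
have [|c [d E1]] := IHs i j.+1; first by rewrite -ltnS.
have [|c' [d' E2]] := IHs i.+1 j; first by rewrite addSnnS -ltnS.
exists (a * c + b * v * c'), (a * u * d + b * d').
have -> : p ^+ (i.+1 + j.+1) = a * (u * p ^+ (i + j.+1)) + b * (v * p ^+ (i.+1 + j)).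
  by rewrite addSn exprS {1}Ep -addSnnS; ring.
by rewrite E1 E2 !exprS; ring.
Qed.

(** An element [P] of the ideal lies in [(z, t)], so [P^(2n)] lies in [(z^n, t^n)]; as [z^n P] and
    [t^n P] lie in [(f, h_0)], so does [P^(2n+1)]. *)
Lemma rad_ideal_radical p : rad_ideal p -> radical (ideal2 f (h 0)) p.
Proof.
have [J0 JD JM] := ideal2_is_ideal z t; have [I0 ID IM] := ideal2_is_ideal f (h 0).
have If : ideal2 f (h 0) f by exists 1, 0; rewrite mul1r mul0r addr0.
have Ih0 : ideal2 f (h 0) (h 0) by exists 0, 1; rewrite mul1r mul0r add0r.
move=> [u <- {p}]; rewrite -[u]hsubmxK; move: (lsubmx u) (rsubmx u) => c C.
rewrite mul_rad_aug; set P := _ + _.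
have [a [b Eab]] : ideal2 z t P.
  apply: (JD); first by exists (- c 0 0 * Y), (c 0 0 * X); rewrite /f; ring.
  apply: ideal_sum => [|p _]; first exact: ideal2_is_ideal.
  (* Here [p <= n] leaves a factor [t] in the second term of [h_p]. *)
  exists (C 0 p * (X ^+ p * z ^+ (n.+1 - p))), (- (C 0 p * (x * Y ^+ p * t ^+ (n - p)))).
  by rewrite /rad_gen subSn ?leq_ord // !exprS; ring.
have nP v W : (forall p, (p <= n.+1)%N -> exists q, v ^+ p * h p = W ^+ p * h 0 + q * f) ->
    ideal2 f (h 0) (v ^+ n * P).
  move=> vW; rewrite mulrDr; apply: (ID); first by rewrite mulrA; apply: IM.
  rewrite mulr_sumr; apply: ideal_sum => [|p _]; first exact: ideal2_is_ideal.
  have [q Eq] := vW p (ltnW (ltn_ord p)).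
  have -> : v ^+ n * (C 0 p * h p) = C 0 p * v ^+ (n - p) * (v ^+ p * h p).
    have -> : v ^+ n = v ^+ (n - p) * v ^+ p by rewrite -exprD subnK // leq_ord.
    by ring.
  by rewrite Eq; apply: (IM); apply: (ID); apply: IM.
have [a' [b' E]] := ideal2_expr n n (ex_intro _ a (ex_intro _ b Eab)).
exists (n + n).+1 => //; rewrite exprSr E mulrDl.
apply: (ID); rewrite -mulrA; apply: IM.
  by apply: nP => p; apply: rad_gen_zX.
by apply: nP => p; apply: rad_gen_tY.
Qed.

End Radical.

(** * Regularity conditions in four variables, checked by setting variables to zero *)

Section FourVariables.
Variable K : fieldType.
Local Notation S := {mpoly K[4]}.
Local Notation x := (var_x K).
Local Notation y := (var_y K).
Local Notation z := (var_z K).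
Local Notation t := (var_t K).
Local Notation i0 := (@Ordinal 4 0 isT).
Local Notation i1 := (@Ordinal 4 1 isT).
Local Notation i2 := (@Ordinal 4 2 isT).
Local Notation i3 := (@Ordinal 4 3 isT).
Implicit Types (p : S) (mu nu : 'X_{1..4}).

Lemma big_ord4 (T : Type) (idx : T) (op : Monoid.law idx) (F : 'I_4 -> T) :
  \big[op/idx]_i F i = op (F i0) (op (F i1) (op (F i2) (F i3))).
Proof.
rewrite !big_ord_recl big_ord0 Monoid.mulm1.
by congr (op (F _) (op (F _) (op (F _) (F _)))); apply: val_inj.
Qed.

Lemma mpolyX4 mu : 'X_[mu] = x ^+ mu i0 * y ^+ mu i1 * z ^+ mu i2 * t ^+ mu i3 :> S.
Proof. by rewrite mpolyXE_id big_ord4 /= !mulrA. Qed.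

Definition mnm4 a b c d : 'X_{1..4} := [multinom nth 0%N [:: a; b; c; d] i | i < 4].

Lemma mpoly_mnm4 a b c d : 'X_[mnm4 a b c d] = x ^+ a * y ^+ b * z ^+ c * t ^+ d :> S.
Proof. by rewrite mpolyX4 !mnmE. Qed.

Lemma mnm4_eq mu nu : mu i0 = nu i0 -> mu i1 = nu i1 -> mu i2 = nu i2 -> mu i3 = nu i3 ->
  mu = nu.
Proof.
move=> e0 e1 e2 e3; apply/mnmP; case=> [[|[|[|[|//]]]] lti].
- by rewrite (_ : Ordinal lti = i0) //; apply: val_inj.
- by rewrite (_ : Ordinal lti = i1) //; apply: val_inj.
- by rewrite (_ : Ordinal lti = i2) //; apply: val_inj.
- by rewrite (_ : Ordinal lti = i3) //; apply: val_inj.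
Qed.

(** Row [i] of [W] is the exponent vector of the image of variable [i] under a monomial map. *)
Definition weights l (W : seq (seq nat)) (i : 'I_4) : 'X_{1..l} :=
  [multinom nth 0%N (nth [::] W i) j | j < l].

Lemma weightsE l W mu (j : 'I_l) : (\sum_i weights l W i *+ mu i)%MM j =
  (nth 0 (nth [::] W 0) j * mu i0 + (nth 0 (nth [::] W 1) j * mu i1
  + (nth 0 (nth [::] W 2) j * mu i2 + nth 0 (nth [::] W 3) j * mu i3)))%N.
Proof. by rewrite mnm_sumE big_ord4 /= !mulmnE !mnmE. Qed.

Section Kills.
Variable A : pred 'I_4.
Lemma kill_x : kill 4 K A x = if A i0 then 0 else x. Proof. exact: killU. Qed.
Lemma kill_y : kill 4 K A y = if A i1 then 0 else y. Proof. exact: killU. Qed.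
Lemma kill_z : kill 4 K A z = if A i2 then 0 else z. Proof. exact: killU. Qed.
Lemma kill_t : kill 4 K A t = if A i3 then 0 else t. Proof. exact: killU. Qed.
End Kills.
Definition kill_var := (kill_x, kill_y, kill_z, kill_t).

Lemma var_neq0 (i : 'I_4) : 'X_i != 0 :> S.
Proof. by apply/eqP => /(congr1 (mcoeff U_(i)%MM))/eqP; rewrite mcoeffX eqxx mcoeff0 oner_eq0. Qed.

Lemma z_dvd p : kill 4 K (pred1 i2) p = 0 -> exists s, p = s * z.
Proof.
move=> p0; have := @kill_ideal 4 K (pred1 i2) _ p (multiples_is_ideal z).
rewrite p0 subr0; apply=> i /eqP ->; by exists 1; rewrite mul1r.
Qed.

Lemma zt_ideal p : kill 4 K (pred2 i2 i3) p = 0 -> exists u v, p = u * z + v * t.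
Proof.
move=> p0; have := @kill_ideal 4 K (pred2 i2 i3) _ p (ideal2_is_ideal z t).
rewrite p0 subr0; apply=> i /orP[]/eqP ->; [exists 1, 0|exists 0, 1].
  by rewrite mul1r mul0r addr0.
by rewrite mul1r mul0r add0r.
Qed.

Lemma zt_syzygy (a b : S) : a * z + b * t = 0 -> exists s, a = s * t /\ b = - (s * z).
Proof.
move=> ab0; have /z_dvd[s Es] : kill 4 K (pred1 i2) b = 0.
  move/(congr1 (kill 4 K (pred1 i2))): ab0.
  rewrite rmorphD !rmorphM /= !kill_var /= rmorph0 mulr0 add0r => /eqP.
  by rewrite mulf_eq0 (negbTE (var_neq0 _)) orbF => /eqP.
exists (- s); split; last by rewrite Es; ring.
apply: (mulIf (var_neq0 i2)); apply: (addIr (b * t)); rewrite -/z ab0 Es; ring.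
Qed.

(** * The surface [f = 0] *)

Section Binomial.
Variable m : nat.
Hypothesis m_gt0 : (0 < m)%N.
Let f : S := x ^+ m * t - y ^+ m * z.

Lemma z_reg_xm (a s : S) : x ^+ m * a = s * z -> exists s', a = s' * z.
Proof.
move/(congr1 (kill 4 K (pred1 i2))); rewrite !rmorphM rmorphXn /= !kill_var /= mulr0 => /eqP.
by rewrite mulf_eq0 expf_eq0 (negbTE (var_neq0 _)) andbF => /eqP/z_dvd.
Qed.

Lemma xm_reg_zt (a : S) i (u v : S) : a * (x ^+ m) ^+ i = u * z + v * t ->
  exists u' v', a = u' * z + v' * t.
Proof.
move/(congr1 (kill 4 K (pred2 i2 i3))).
rewrite rmorphD !rmorphM !rmorphXn /= !kill_var /= !mulr0 addr0 => /eqP.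
by rewrite mulf_eq0 !expf_eq0 (negbTE (var_neq0 _)) !andbF orbF => /eqP/zt_ideal.
Qed.

(** At [z = 0] the equation becomes [0 = s x^m t], so [z] divides [s]. *)
Lemma z_reg_f (a s : S) : a * z = s * f -> exists s', a = s' * f.
Proof.
move=> E; have /z_dvd[s' Es] : kill 4 K (pred1 i2) s = 0.
  move/(congr1 (kill 4 K (pred1 i2))): (E).
  rewrite rmorphM [in RHS]rmorphM rmorphB !rmorphM !rmorphXn /= !kill_var /= !mulr0 subr0.
  move/esym/eqP; rewrite !mulf_eq0 !expf_eq0 !(negbTE (var_neq0 _)) andbF !orbF.
  by move/eqP.
exists s'; apply: (mulIf (var_neq0 i2)); rewrite -/z E Es; ring.
Qed.

Lemma comp_weights l W (i : 'I_4) :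
  'X_i \mPo [tuple 'X_[K, weights l W i] | i < 4] = 'X_[weights l W i].
Proof. by rewrite comp_mpolyXU -tnth_nth tnth_mktuple. Qed.

(* The surface [f = 0] is parametrised by [(u, v, u^m s, v^m s)]. *)
Let W := [:: [:: 1; 0; 0]; [:: 0; 1; 0]; [:: m; 0; 1]; [:: 0; m; 1]]%N.
Let psi : S -> {mpoly K[3]} := comp_mpoly [tuple 'X_[K, weights 3 W i] | i < 4].

Lemma surface_f : psi f = 0.
Proof.
rewrite /psi /f rmorphB !rmorphM !rmorphXn /= !comp_weights.
rewrite !mpolyXn -!mpolyXD; apply/eqP; rewrite subr_eq0; apply/eqP; congr 'X_[_].
by apply/mnmP; case=> [[|[|[|//]]] ltj]; rewrite !mnmDE !mulmnE !mnmE /=; lia.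
Qed.

(** Rewriting [y^m z] to [x^m t] lowers the exponent of [y]; the remaining monomials have distinct
    images under [psi]. *)
Lemma surface_kernel p : psi p = 0 -> exists s, p = s * f.
Proof.
pose nf mu := (mu i1 < m)%N || (mu i2 == 0%N).
have [mu|r [[s Es] nr]] := @normal_form 4 K _ nf (fun mu => mu i1) (multiples_is_ideal f) _ p.
  rewrite /nf negb_or -leqNgt -lt0n => /andP[mb c0].
  exists (mnm4 (mu i0 + m) (mu i1 - m) (mu i2).-1 (mu i3).+1); split.
    by rewrite mnmE /=; lia.
  exists (- (x ^+ mu i0 * y ^+ (mu i1 - m) * z ^+ (mu i2).-1 * t ^+ mu i3)).
  rewrite mpolyX4 mpoly_mnm4 -{1}(subnK mb) -{1}(prednK c0) !exprD !exprS /f; ring.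
move=> p0; exists s; suff r0 : r = 0 by rewrite -Es r0 subr0.
apply: (@comp_monomials_inj 4 K 3 (weights 3 W)).
  move=> mu nu /nr nmu /nr nnu e; move: nmu nnu; rewrite /nf.
  have := congr1 (fun q : 'X_{1..3} => q (@Ordinal 3 0 isT)) e.
  have := congr1 (fun q : 'X_{1..3} => q (@Ordinal 3 1 isT)) e.
  have := congr1 (fun q : 'X_{1..3} => q (@Ordinal 3 2 isT)) e.
  rewrite !weightsE /= => e2 e1 e0 nmu nnu.
  (* If [mu] has the larger exponent of [z], it has the smaller one of [t], hence [y] occurs in it
     at least [m] times, against normality; the other case is symmetric. *)
  have ec : mu i2 = nu i2.
    apply/eqP; rewrite eqn_leq; apply/andP; split; rewrite leqNgt; apply/negP => lt; nia.
  by apply: mnm4_eq => //; nia.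
have -> : r = p - s * f by rewrite -Es subKr.
by rewrite rmorphB rmorphM /= -/(psi p) -/(psi f) p0 surface_f mulr0 subr0.
Qed.

(** As the kernel of a map to a domain, [(f)] is prime, so the second generator only needs a nonzero
    image: its two terms have different exponents of [v]. *)
Lemma g_reg_f n (a s : S) : a * (z ^+ (n + 2) - x * t ^+ (n + 1)) = s * f ->
  exists s', a = s' * f.
Proof.
move=> E; apply: surface_kernel; move/(congr1 psi): E.
rewrite /psi !rmorphM /= -/(psi f) surface_f mulr0 => /eqP; rewrite mulf_eq0.
case/orP=> [/eqP //|]; rewrite rmorphB !rmorphM !rmorphXn /= !comp_weights.
rewrite !mpolyXn -!mpolyXD => /eqP/(congr1 (mcoeff (weights 3 W i2 *+ (n + 2))%MM))/eqP.
rewrite mcoeffB !mcoeffX eqxx mcoeff0.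
case: (@eqP 'X_{1..3}) => [|_]; last by rewrite subr0 oner_eq0.
move/(congr1 (fun q : 'X_{1..3} => q (@Ordinal 3 1 isT))).
by rewrite !mnmDE !mulmnE !mnmE /=; lia.
Qed.

Lemma first_gen_neq0 : f != 0.
Proof.
apply/eqP => /(congr1 (kill 4 K (pred1 i2)))/eqP.
rewrite rmorphB !rmorphM !rmorphXn rmorph0 /= !kill_var /= mulr0 subr0.
by rewrite mulf_eq0 expf_eq0 !(negbTE (var_neq0 _)) andbF.
Qed.

End Binomial.
End FourVariables.

(** * Normal monomials are separated by the monomial curve *)

Section CurveExponents.
Variables m n : nat.
Hypothesis m_gt0 : (0 < m)%N.

Definition normal_exponents a b c d :=
  ((b < m)%N || (c == 0)%N) &&
  [forall p : 'I_n.+1, ~~ [&& 0 < a, p * m <= b & n.+1 - p <= d]%N].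

(** The two positivity conditions say that the monomial vanishes on [x = z = 0] and on
    [z = t = 0]. *)
Lemma normal_exponentsP a b c d (p := (b %/ m)%N) : normal_exponents a b c d ->
    (0 < a)%N || (0 < c)%N -> (0 < c)%N || (0 < d)%N ->
  [/\ p = 0%N \/ c = 0%N, a = 0%N -> p = 0%N & (0 < a)%N -> (p + d <= n)%N].
Proof.
move=> /andP[bc /forallP nf] ac cd.
have pc : p = 0%N \/ c = 0%N by case/orP: bc => [/divn_small|/eqP]; [left|right].
split=> // [a0|a_gt0]; first by move: ac; rewrite a0 /=; case: pc => // ->.
have pb : (p * m <= b)%N by apply: leq_trunc_div.
have [pn|np] := leqP p n.
  by have := nf (Ordinal (pn : p < n.+1)%N); rewrite a_gt0 /= pb /=; lia.
(* For [p > n], the excluded monomial of index [n] forces [d = 0], hence [c > 0], whereas [p > 0]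
   forces [c = 0]. *)
have := nf ord_max; rewrite a_gt0 /= subSnn (leq_trans _ pb) ?leq_mul2r ?(ltnW np) ?orbT //=.
move: pc cd; case: c {bc ac} => [|c] pc cd; first by rewrite -leqNgt leqn0; case: d cd {nf}.
by case: pc np => // ->.
Qed.

(** If [e' < e] then [r' >= n + 1], so [a' = 0] and [q' = 0], and the last equation gives
    [a + q + e = e' < e]. *)
Lemma no_carry a q e r a' q' e' r' : (a' = 0%N -> q' = 0%N) -> ((0 < a')%N -> (r' <= n)%N) ->
  (n.+1 * e + r = n.+1 * e' + r')%N -> (a + q + e = a' + q' + e')%N -> (e <= e')%N.
Proof.
move=> aq ar E D; rewrite leqNgt; apply/negP => lt_e'e.
have : (n.+1 * e'.+1 <= n.+1 * e)%N by rewrite leq_mul2l.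
move: E; rewrite mulnS; move: (n.+1 * e)%N (n.+1 * e')%N => u u' E le_u.
by case: (posnP a') => [/[dup] a0 /aq q0|/ar]; lia.
Qed.

(* With [p = b %/ m], both [c + d] and [p + d] can be read off
   [(n + 1) (c + d) + (p + d)]: a carry would force [a = 0], hence [p = 0] and a
   total degree that is too small. *)
Lemma normal_exponents_inj a b c d a' b' c' d' (l := (m * n.+2)%N) :
  normal_exponents a b c d -> (0 < a)%N || (0 < c)%N -> (0 < c)%N || (0 < d)%N ->
  normal_exponents a' b' c' d' -> (0 < a')%N || (0 < c')%N -> (0 < c')%N || (0 < d')%N ->
  (l * a + (l.-1 * b + m * c) = l * a' + (l.-1 * b' + m * c'))%N ->
  (b + (m * n.+1 * c + l * d) = b' + (m * n.+1 * c' + l * d'))%N ->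
  [/\ a = a', b = b', c = c' & d = d'].
Proof.
move=> nf ac cd nf' ac' cd' e1 e2.
have [pc ap adn] := normal_exponentsP nf ac cd.
have [pc' ap' adn'] := normal_exponentsP nf' ac' cd'.
have bE := divn_eq b m; have b'E := divn_eq b' m.
move: (b %/ m)%N (b' %/ m)%N pc ap adn pc' ap' adn' bE b'E => p p' pc ap adn pc' ap' adn' bE b'E.
have l_gt0 : (0 < l)%N by rewrite muln_gt0 m_gt0.
have eb : (b %% m = b' %% m)%N.
  move/(congr1 (modn^~ m)): e2; rewrite /l -!mulnA -!mulnDr.
  by rewrite ![(_ + m * _)%N]addnC ![(m * _)%N]mulnC !modnMDl.
have eE : (p + (n.+1 * c + n.+2 * d) = p' + (n.+1 * c' + n.+2 * d'))%N.
  apply/eqP; rewrite -(eqn_pmul2l m_gt0); apply/eqP; apply: (@addnI (b %% m)%N).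
  by move: e2; rewrite /l {1}bE {1}b'E eb; lia.
(* The two weights of each variable add up to [l], so the sum of the two equations is [l] times the
   total degree. *)
have eD : (a + b + c + d = a' + b' + c' + d')%N.
  apply/eqP; rewrite -(eqn_pmul2l l_gt0); apply/eqP.
  have lE : l = (l.-1 + 1)%N by lia.
  have lmc u : (l * u = m * n.+1 * u + m * u)%N by rewrite /l; ring.
  have lb u : (l * u = l.-1 * u + u)%N by rewrite {1}lE; ring.
  rewrite !mulnDr; have := lmc c; have := lmc c'; have := lb b; have := lb b'; lia.
have eDp : (a + p * m + (c + d) = a' + p' * m + (c' + d'))%N.
  by move: eD; rewrite {1}bE {1}b'E eb; clear; lia.
have eEr : (n.+1 * (c + d) + (p + d) = n.+1 * (c' + d') + (p' + d'))%N.
  have regroup u v w : (n.+1 * (u + v) + (w + v) = w + (n.+1 * u + n.+2 * v))%N by ring.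
  by rewrite !regroup.
have ee : (c + d = c' + d')%N.
  have apm : a = 0%N -> (p * m = 0)%N by move=> /ap ->.
  have apm' : a' = 0%N -> (p' * m = 0)%N by move=> /ap' ->.
  apply/eqP; rewrite eqn_leq (no_carry apm' adn' eEr eDp).
  by rewrite (no_carry apm adn (esym eEr) (esym eDp)).
have ep : (p + d = p' + d')%N by move: eEr; rewrite ee => /addnI.
(* The difference [c - p] is known and one of [c], [p] is zero. *)
have [ep' ec ed] : [/\ p = p', c = c' & d = d'].
  by move: pc pc' ee ep; clear; case=> ?; case=> ?; split; lia.
rewrite bE b'E eb ep' ec ed; split=> //.
by move: eDp; rewrite ee ep' => /addIn/addIn.
Qed.

End CurveExponents.

(** * The radical is generated by [f] and the [h_p] *)

Section CurveRadical.
Variables (K : fieldType) (m N : nat).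
Hypothesis m_gt0 : (0 < m)%N.
Let n := N.+1.
Local Notation S := {mpoly K[4]}.
Local Notation x := (var_x K).
Local Notation y := (var_y K).
Local Notation z := (var_z K).
Local Notation t := (var_t K).
Local Notation i0 := (@Ordinal 4 0 isT).
Local Notation i1 := (@Ordinal 4 1 isT).
Local Notation i2 := (@Ordinal 4 2 isT).
Local Notation i3 := (@Ordinal 4 3 isT).
Local Notation h := (rad_gen x (x ^+ m) (y ^+ m) z t N).
Let f : S := x ^+ m * t - y ^+ m * z.
Let J := rad_ideal x (x ^+ m) (y ^+ m) z t N.

Lemma rad_ideal_is_ideal : is_ideal J.
Proof. exact: col_ideal_is_ideal. Qed.

Lemma rad_normal_form (p : S) : exists r, J (p - r) /\
  {in msupp r, forall mu : 'X_{1..4}, normal_exponents m n (mu i0) (mu i1) (mu i2) (mu i3)}.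
Proof.
have [J0 JD JM] := rad_ideal_is_ideal.
pose nf (mu : 'X_{1..4}) := normal_exponents m n (mu i0) (mu i1) (mu i2) (mu i3).
(* Weight 2 on [y] makes both rewritings decrease: [f] trades [y^m] for [x^m], and [h_p] trades
   [x y^(pm)] for [x^(pm)]. *)
apply: (@normal_form 4 K J nf (fun mu => 2 * mu i1 + mu i0)%N rad_ideal_is_ideal) => {p} mu.
rewrite /nf negb_and negb_or -leqNgt -lt0n => /orP[/andP[mb c0]|/forallPn[p]].
  exists (mnm4 (mu i0 + m) (mu i1 - m) (mu i2).-1 (mu i3).+1); split.
    by rewrite !mnmE /=; lia.
  have -> : 'X_[mu] - 'X_[mnm4 (mu i0 + m) (mu i1 - m) (mu i2).-1 (mu i3).+1] =
      - (x ^+ mu i0 * y ^+ (mu i1 - m) * z ^+ (mu i2).-1 * t ^+ mu i3) * f.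
    by rewrite mpolyX4 mpoly_mnm4 -{1}(subnK mb) -{1}(prednK c0) !exprD !exprS /f; ring.
  by apply: JM; apply: rad_ideal_f.
rewrite negbK => /and3P[a0 pb pd].
pose mu' := mnm4 ((mu i0).-1 + m * p) (mu i1 - p * m) (mu i2 + (n.+1 - p).+1) (mu i3 - (n.+1 - p)).
exists mu'; split.
  have : (p * m <= 2 * (p * m))%N by lia.
  rewrite !mnmE /= [(m * p)%N]mulnC; lia.
have -> : 'X_[mu] - 'X_[mu'] =
    - (x ^+ (mu i0).-1 * y ^+ (mu i1 - p * m) * z ^+ mu i2 * t ^+ (mu i3 - (n.+1 - p))) * h p.
  rewrite /mu' mpolyX4 mpoly_mnm4 -{1}(subnK pb) -{1}(prednK a0) -{1}(subnK pd) /rad_gen.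
  by rewrite -!exprM ![(m * p)%N]mulnC !exprD !exprS; ring.
by apply: JM; apply: rad_ideal_gen; rewrite leq_ord.
Qed.

Lemma radical_morph0 (T : idomainType) (s : {rmorphism S -> T}) (p : S) :
  s f = 0 -> s (h 0) = 0 -> radical (ideal2 f (h 0)) p -> s p = 0.
Proof.
move=> sf sh [e e0 [a [b E]]]; apply/eqP; suff: s p ^+ e == 0 by rewrite expf_eq0 e0.
by rewrite -(rmorphXn s e p) E rmorphD !rmorphM sf sh !mulr0 addr0.
Qed.

Lemma rad_gen0_morph (T : idomainType) (s : {rmorphism S -> T}) :
  s (h 0) = s z ^+ n.+2 - s x * s t ^+ n.+1.
Proof.
rewrite /rad_gen !expr0 mul1r mulr1 subn0 -/n -(rmorphXn s n.+2 z) -(rmorphXn s n.+1 t).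
by rewrite -(rmorphM s) -(rmorphB s).
Qed.

Let W := [:: [:: m * n.+2; 0]; [:: (m * n.+2).-1; 1]; [:: m; m * n.+1]; [:: 0; m * n.+2]]%N.
Let phi : S -> {mpoly K[2]} := comp_mpoly [tuple 'X_[K, weights 2 W i] | i < 4].

Lemma curve_f : phi f = 0.
Proof.
rewrite /phi /f rmorphB !rmorphM !rmorphXn /= !comp_weights.
rewrite !mpolyXn -!mpolyXD; apply/eqP; rewrite subr_eq0; apply/eqP; congr 'X_[_].
by apply/mnmP; case=> [[|[|//]] ltj]; rewrite !mnmDE !mulmnE !mnmE /=; nia.
Qed.

Lemma curve_h0 : phi (h 0) = 0.
Proof.
rewrite /phi rad_gen0_morph /= !comp_weights.
rewrite !mpolyXn -!mpolyXD; apply/eqP; rewrite subr_eq0; apply/eqP; congr 'X_[_].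
by apply/mnmP; case=> [[|[|//]] ltj]; rewrite mulmnE [RHS]mnmDE mulmnE !mnmE /=; nia.
Qed.

(** The normal form [r] of an element of the radical vanishes on all three components. The two lines
    rule out monomials of [r] without [x, z] or without [z, t]; on the curve the others have
    distinct images, so [r = 0]. *)
Lemma radical_rad_ideal (p : S) : radical (ideal2 f (h 0)) p <-> J p.
Proof.
split=> [Ip|]; last exact: rad_ideal_radical.
have [J0 JD JM] := rad_ideal_is_ideal.
have [r [Jr nr]] := rad_normal_form p.
have Ir (T : idomainType) (s : {rmorphism S -> T}) : s f = 0 -> s (h 0) = 0 -> s r = 0.
  move=> sf sh; have -> : r = p - (p - r) by rewrite subKr.
  by rewrite rmorphB !(radical_morph0 sf sh) ?subrr //; apply: rad_ideal_radical.
suff r0 : r = 0 by move: Jr; rewrite r0 subr0.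
have xz mu : mu \in msupp r -> (0 < mu i0)%N || (0 < mu i2)%N.
  apply: contraLR; rewrite negb_or -!eqn0Ngt => /andP[/eqP a0 /eqP c0].
  rewrite -mcoeff_eq0 -(@kill_coef 4 K (pred2 i0 i2)) ?Ir ?mcoeff0 //.
  - by rewrite /f /= rmorphB !rmorphM !rmorphXn /= !kill_var /= expr0n gtn_eqF //
      !(mul0r, mulr0) subrr.
  - by rewrite rad_gen0_morph /= !kill_var /= expr0n mul0r subrr.
  - by apply/forallP => i; apply/implyP => /orP[]/eqP->; rewrite ?a0 ?c0.
have zt mu : mu \in msupp r -> (0 < mu i2)%N || (0 < mu i3)%N.
  apply: contraLR; rewrite negb_or -!eqn0Ngt => /andP[/eqP c0 /eqP d0].
  rewrite -mcoeff_eq0 -(@kill_coef 4 K (pred2 i2 i3)) ?Ir ?mcoeff0 //.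
  - by rewrite /f /= rmorphB !rmorphM !rmorphXn /= !kill_var /= !mulr0 subrr.
  - by rewrite rad_gen0_morph /= !kill_var /= !expr0n mulr0 subrr.
  - by apply/forallP => i; apply/implyP => /orP[]/eqP->; rewrite ?c0 ?d0.
apply: (@comp_monomials_inj 4 K 2 (weights 2 W)); last first.
  by apply: Ir; [exact: curve_f|exact: curve_h0].
move=> mu nu rmu rnu e.
have := congr1 (fun q : 'X_{1..2} => q (@Ordinal 2 0 isT)) e.
have := congr1 (fun q : 'X_{1..2} => q (@Ordinal 2 1 isT)) e.
rewrite !weightsE /= !mul0n !mul1n add0n !addn0 => e2 e1.
have [] := normal_exponents_inj m_gt0 (nr _ rmu) (xz _ rmu) (zt _ rmu)
  (nr _ rnu) (xz _ rnu) (zt _ rnu) e1 e2.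
exact: mnm4_eq.
Qed.

End CurveRadical.

(** * Homogeneous entries of positive degree *)

Section PositiveDegree.
Variables (N : nat) (K : fieldType).
Implicit Types (d : int) (p : {mpoly K[N]}).

(** One condition on matrix entries yields both the grading and minimality. *)
Definition homog_pos d p := p = 0 \/ exists2 e : nat, d = e.+1 & p \is e.+1.-homog.

Lemma homog_pos_homogz d p : homog_pos d p -> homogz d p.
Proof. by case=> [->|[e ->]//]; case: d => // e; apply: dhomog0. Qed.

Lemma homog_pos_coef0 d p : homog_pos d p -> p@_0%MM = 0.
Proof.
case=> [->|[e _ pe]]; first by rewrite mcoeff0.
by apply: (dhomog_nemf_coeff pe); rewrite mf0.
Qed.

Lemma dhomogXn (i : 'I_N) e : ('X_i : {mpoly K[N]}) ^+ e \is e.-homog.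
Proof. by rewrite mpolyXn dhomogX; apply/eqP; rewrite [LHS]mdegMn mdeg1 mul1n. Qed.

Lemma homog_posE d (e : nat) p : d = e -> (0 < e)%N -> p \is e.-homog -> homog_pos d p.
Proof. by case: e => // e -> _ pe; right; exists e. Qed.

End PositiveDegree.

(** * The Koszul resolution of [I_(m,n)] *)

Section Regularity.
Variables (K : fieldType) (m : nat).
Hypothesis m_gt0 : (0 < m)%N.
Local Notation S := {mpoly K[4]}.
Local Notation x := (var_x K).
Local Notation y := (var_y K).
Local Notation z := (var_z K).
Local Notation t := (var_t K).
Let f : S := x ^+ m * t - y ^+ m * z.

Lemma first_gen_homog : f \is m.+1.-homog.
Proof.
rewrite -[m.+1]addn1 rpredB //; apply: dhomogM; rewrite ?dhomogXn //; exact: (@dhomogXn _ _ _ 1).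
Qed.

Lemma second_gen_homog n : z ^+ (n + 2) - x * t ^+ (n + 1) \is (n + 2).-homog.
Proof.
rewrite rpredB ?dhomogXn // (_ : (n + 2 = 1 + (n + 1))%N); last by lia.
by apply: dhomogM; rewrite ?dhomogXn //; exact: (@dhomogXn _ _ _ 1).
Qed.

(** The shifts are [m + 1], [n + 2] and then [m + n + 3] in homological degree 1, where the maximum
    is attained. *)
Lemma regularity_Imn n : is_regularity (@Imn K m n) (m + n + 2)%N%:Z.
Proof.
set g := z ^+ (n + 2) - x * t ^+ (n + 1).
pose e0 (j : 'I_(1 + 1)) : int := if split j is inl _ then m.+1%:Z else (n + 2)%N%:Z.
pose e1 (j : 'I_1) : int := (m + n + 3)%N%:Z.
pose v : 'cV[S]_(1 + 1) := col_mx f%:M g%:M.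
pose d0 : 'M[S]_(1, 1 + 1) := row_mx g%:M (- f)%:M.
have mulv (a b : 'rV_1) : (row_mx a b *m v) 0 0 = a 0 0 * f + b 0 0 * g.
  by rewrite mul_row_col mxE !mul_mx_scalar !mxE mulrC [_ * g]mulrC.
have d0_pos a b : homog_pos (e1 a - e0 b) (d0 a b).
  rewrite /e0; case: (split_ordP b) => j ->; rewrite !ord1 /d0 ?row_mxEl ?row_mxEr mxE eqxx mulr1n.
    by apply: (@homog_posE _ _ _ (n + 2)); [rewrite /e1; lia|lia|apply: second_gen_homog].
  by apply: (@homog_posE _ _ _ m.+1); [rewrite /e1; lia|lia|rewrite rpredN; apply: first_gen_homog].
apply: (@is_regularity_short 4 K _ 1 0 e0 e1 (fun=> 0) v d0 0).
- move=> j; rewrite /e0; case: (split_ordP j) => i -> /=;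
    rewrite /v ord1 ?col_mxEu ?col_mxEd mxE eqxx mulr1n.
    exact: first_gen_homog.
  exact: second_gen_homog.
- by move=> a b; apply: homog_pos_homogz.
- by case.
- move=> p; split=> [[a [b ->]]|[u <-]].
    by exists (row_mx a%:M b%:M); rewrite mulv !mxE eqxx !mulr1n.
  by rewrite -[u]hsubmxK mulv; eexists; eexists.
- move=> u; split=> [|[w ->]]; last first.
    by rewrite -mulmxA mul_row_col -!scalar_mxM mulNr mulrC raddfN /= subrr mulmx0.
  rewrite -[u]hsubmxK; move: (lsubmx u) (rsubmx u) => a b /matrixP/(_ 0 0).
  rewrite mulv mxE => ab0.
  (* The relation puts [b g] in [(f)], and [g] is regular modulo [f]. *)
  have [s Es] : exists s, b 0 0 = s * f.
    apply: (@g_reg_f K m m_gt0 n _ (- a 0 0)); rewrite -/g -/f; apply/eqP.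
    by rewrite mulNr -subr_eq0 opprK addrC ab0.
  have Ea : a 0 0 = - s * g.
    apply: (mulIf (first_gen_neq0 K m)); apply: (addIr (b 0 0 * g)).
    by rewrite -/f ab0 Es; ring.
  exists (- s)%:M; rewrite mul_mx_row -!scalar_mxM mulrNN.
  by congr row_mx; apply/rowP => i; rewrite !ord1 !mxE eqxx mulr1n.
- move=> u; split=> [|[w ->]]; last by rewrite mulmx0 mul0mx.
  rewrite mul_mx_row -[X in _ = X]row_mx0 => H; have [_ /matrixP/(_ 0 0)] := eq_row_mx H.
  rewrite mul_mx_scalar !mxE => /eqP; rewrite mulf_eq0 oppr_eq0 (negbTE (first_gen_neq0 K m)) /=.
  move=> /eqP u0.
  by exists 0; rewrite mulmx0; apply/rowP => i; rewrite !ord1 mxE.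
- by move=> u _; rewrite [u]thinmx0.
- by move=> a b; apply: homog_pos_coef0 (d0_pos a b).
- by case.
- by move=> j; rewrite /e0; case: split => _; lia.
- by move=> j; rewrite /e1; lia.
- by case.
- by right; exists 0; rewrite /e1; lia.
Qed.

(** * Degrees in the resolution of the radical *)

Section RadicalRegularity.
Variable N : nat.
Let n := N.+1.
Local Notation h := (rad_gen x (x ^+ m) (y ^+ m) z t N).

Definition rad_deg p := (m * p + (n.+1 - p).+1)%N.
Definition rad_deg0 (j : 'I_(1 + n.+1)) : int :=
  match split j with inl _ => m.+1 | inr p => rad_deg p end.
(** Row [p] of either band has a linear entry [z] or [t] in column [p + 1], which fixes its shift;
    [rad_deg2] arises the same way from [rad_diff1]. *)
Definition rad_deg1 (j : 'I_(n + n)) : int :=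
  match split j with inl p => (rad_deg p.+1).+1 | inr p => (rad_deg p.+1).+1 end.
Definition rad_deg2 (j : 'I_N) : int := (rad_deg j.+2).+2.

(** The two entries of a band row, of degrees [1] and [m], give the same shift. *)
Lemma rad_degS p : (p <= n)%N -> ((rad_deg p.+1).+1 = rad_deg p + m)%N.
Proof. rewrite /rad_deg mulnS; lia. Qed.

(** The bound is [rad_deg n], and each step up adds [m - 1 >= 0]. *)
Lemma rad_deg_le p : (p <= n)%N -> (rad_deg p <= m * n + 2)%N.
Proof.
move=> pn; rewrite /rad_deg -(subnK pn).
move: (n - p)%N => e; rewrite mulnDr.
have : (e <= m * e)%N by rewrite leq_pmull.
lia.
Qed.

Lemma xm_homog p : (x ^+ m) ^+ p \is (m * p)%N.-homog.
Proof. by rewrite -exprM dhomogXn. Qed.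

Lemma ym_homog p : (y ^+ m) ^+ p \is (m * p)%N.-homog.
Proof. by rewrite -exprM dhomogXn. Qed.

Lemma rad_gen_homog p : (p <= n)%N -> h p \is (rad_deg p).-homog.
Proof.
move=> pn; rewrite /rad_gen rpredB //.
  by apply: dhomogM; [apply: xm_homog|apply: dhomogXn].
rewrite (_ : rad_deg p = 1 + m * p + (n.+1 - p))%N; last by rewrite /rad_deg; lia.
apply: dhomogM; [apply: dhomogM; [exact: (@dhomogXn _ _ _ 1)|exact: ym_homog]|exact: dhomogXn].
Qed.

Lemma band_lin_pos d e (c b : S) (D : nat -> nat -> int) :
  (forall p, (p < d)%N -> homog_pos (D p p.+1) c) ->
  (forall p, (p < d)%N -> homog_pos (D p p) b) ->
  forall (p : 'I_d) (q : 'I_e), homog_pos (D p q) (band d e (c *: 'X - b%:P) p q).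
Proof.
move=> Dc Db p q; rewrite bandE lin_mulXnE !(coefB, coefZ, coefXn).
have [-> |qp1] := eqVneq (q : nat) p.+1.
  by rewrite gtn_eqF //= mulr0 subr0 mulr1; apply: Dc.
have [-> |qp] := eqVneq (q : nat) p; last by left; rewrite !mulr0 subrr.
rewrite mulr0 sub0r mulr1; case: (Db p (ltn_ord p)) => [->|[i -> bi]].
  by left; rewrite oppr0.
by right; exists i; rewrite // rpredN.
Qed.

Lemma rad_diff0_pos a b :
  homog_pos (rad_deg1 a - rad_deg0 b) (rad_diff0 x (x ^+ m) (y ^+ m) z t N a b).
Proof.
have lin (v : 'I_4) (w : S) : w \is m.-homog -> forall (p : 'I_n) (q : 'I_n.+1),
    homog_pos ((rad_deg p.+1).+1%:Z - (rad_deg q)%:Z) (band n n.+1 ('X_v *: 'X - w%:P) p q).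
  move=> wm; apply: (band_lin_pos (D := fun p q => (rad_deg p.+1).+1%:Z - (rad_deg q)%:Z)).
    move=> p pn; apply: (@homog_posE _ _ _ 1) => //; first by lia.
    exact: (@dhomogXn _ _ v 1).
  by move=> p pn; apply: (@homog_posE _ _ _ m) => //; rewrite rad_degS 1?ltnW //; lia.
rewrite /rad_deg1 /rad_deg0 /rad_diff0.
case: (split_ordP a) => p ->; case: (split_ordP b) => q ->.
- rewrite block_mxEul mxE; apply: (@homog_posE _ _ _ (1 + m * p + (n - p))).
  + by rewrite rad_degS 1?ltnW // /rad_deg; have := ltn_ord p; lia.
  + by [].
  rewrite rpredN; apply: dhomogM; last exact: dhomogXn.
  by apply: dhomogM; [exact: (@dhomogXn _ _ _ 1)|exact: ym_homog].
- by rewrite block_mxEur; apply: lin; apply: dhomogXn.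
- rewrite block_mxEdl mxE; apply: (@homog_posE _ _ _ (m * p + (n - p).+1)).
  + by rewrite rad_degS 1?ltnW // /rad_deg; have := ltn_ord p; lia.
  + by rewrite addnS.
  by rewrite rpredN; apply: dhomogM; [exact: xm_homog|exact: dhomogXn].
- by rewrite block_mxEdr; apply: lin; apply: dhomogXn.
Qed.

Lemma rad_diff1_pos a b :
  homog_pos (rad_deg2 a - rad_deg1 b) (rad_diff1 (x ^+ m) (y ^+ m) z t N a b).
Proof.
have lin (v : 'I_4) (w : S) : w \is m.-homog -> forall (p : 'I_N) (q : 'I_n),
    homog_pos ((rad_deg p.+2).+2%:Z - (rad_deg q.+1).+1%:Z) (band N n ('X_v *: 'X - w%:P) p q).
  move=> wm; apply: (band_lin_pos (D := fun p q => (rad_deg p.+2).+2%:Z - (rad_deg q.+1).+1%:Z)).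
    move=> p pn; apply: (@homog_posE _ _ _ 1) => //; first by lia.
    exact: (@dhomogXn _ _ v 1).
  by move=> p pn; apply: (@homog_posE _ _ _ m) => //; rewrite rad_degS //; lia.
rewrite /rad_deg1 /rad_deg2 /rad_diff1.
case: (split_ordP b) => q ->; rewrite ?row_mxEl ?row_mxEr.
  by apply: lin; apply: dhomogXn.
rewrite mxE; have [->|[e E]] := lin (@Ordinal 4 2 isT) (x ^+ m) (dhomogXn K _ m) a q.
  by left; rewrite oppr0.
by right; exists e; rewrite // rpredN.
Qed.

(** In homological degree [i], the shifts minus [i] are values [rad_deg (p + i)] with [p + i <= n],
    besides [m + 1] from [f]; so the maximum is the degree of [h_n]. *)
Lemma regularity_rad_ideal :
  is_regularity (rad_ideal x (x ^+ m) (y ^+ m) z t N) (m * n + 2)%N%:Z.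
Proof.
have zs := @zt_syzygy K; have zx := @z_reg_xm K m; have xzt := @xm_reg_zt K m.
have zf := @z_reg_f K m; have f0 := first_gen_neq0 K m.
have hf a s : a * h 0 = s * f -> exists s', a = s' * f.
  move=> E; apply: (@g_reg_f K m m_gt0 n a s); rewrite -/f -E /rad_gen !expr0 mul1r mulr1.
  by rewrite addn2 addn1.
have deg_le p : (p <= n)%N -> (rad_deg p)%:Z <= (m * n + 2)%N%:Z.
  by move=> pn; rewrite lez_nat rad_deg_le.
apply: (@is_regularity_short 4 K _ _ _ rad_deg0 rad_deg1 rad_deg2
  (rad_aug x (x ^+ m) (y ^+ m) z t N) (rad_diff0 x (x ^+ m) (y ^+ m) z t N)
  (rad_diff1 (x ^+ m) (y ^+ m) z t N)).
- move=> j; rewrite /rad_deg0 /rad_aug; case: (split_ordP j) => p ->.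
    by rewrite col_mxEu ord1 mxE eqxx mulr1n; apply: first_gen_homog.
  by rewrite col_mxEd mxE; apply: rad_gen_homog; rewrite leq_ord.
- by move=> a b; apply: homog_pos_homogz (rad_diff0_pos a b).
- by move=> a b; apply: homog_pos_homogz (rad_diff1_pos a b).
- by [].
- by move=> u; apply: rad_exact0.
- by move=> u; apply: rad_exact1.
- by move=> u; apply: rad_exact2; apply: var_neq0.
- by move=> a b; apply: homog_pos_coef0 (rad_diff0_pos a b).
- by move=> a b; apply: homog_pos_coef0 (rad_diff1_pos a b).
- move=> j; rewrite /rad_deg0; case: split => [_|p]; last by apply: deg_le; rewrite leq_ord.
  by rewrite lez_nat /n mulnS; lia.
- move=> j; rewrite /rad_deg1.
  by case: split => p; have := deg_le p.+1 (ltn_ord p); lia.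
- by move=> j; rewrite /rad_deg2; have := deg_le j.+2 (ltn_ord j); lia.
left; exists (rshift 1 ord_max); rewrite /rad_deg0 (unsplitK (inr ord_max)) /rad_deg /=.
by rewrite subSnn.
Qed.

End RadicalRegularity.
End Regularity.

(** * Transport to the radical and conclusion *)

Lemma is_regularity_eq N (K : fieldType) (I I' : {mpoly K[N]} -> Prop) r :
  (forall p, I' p <-> I p) -> is_regularity I r -> is_regularity I' r.
Proof.
move=> eqI [F [minF attF leF]].
have im p : I' p <-> exists u : 'rV_(gfr_rank F 0), (u *m gfr_aug F) 0 0 = p.
  by rewrite eqI; apply: gfr_aug_image.
by exists (@GradedFreeResolution N K I' _ _ _ _ (@gfr_aug_homog _ _ _ F)
  (@gfr_diff_homog _ _ _ F) im (@gfr_exact0 _ _ _ F) (@gfr_exactS _ _ _ F)).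
Qed.

Theorem lemma2p4 (k : fieldType) (m n : nat) (hm : (1 <= m)%N) (hn : (1 <= n)%N) :
  is_regularity (@Imn k m n) (m + n + 2)%N%:Z /\
  is_regularity (radical (@Imn k m n)) (m * n + 2)%N%:Z.
Proof.
split; first exact: regularity_Imn.
(* Since [n >= 1], it has the form [N + 1]; the second generator is then [h_0]. *)
case: n hn => // N _; apply: is_regularity_eq (regularity_rad_ideal k hm N) => p.
rewrite -(@radical_rad_ideal k m N hm) /rad_gen !expr0 mul1r mulr1 subn0.
by rewrite /Imn addn2 addn1.
Qed.
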